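(* Let $(\Omega,\mathcal{H},\mathbb{P})$ be a probability space, let $\mathcal{F}\subset\mathcal{G}\subset\mathcal{H}$ be $\sigma$-fields, and let $X$ be a square integrable real random variable defined on $(\Omega,\mathcal{H},\mathbb{P})$. Then, almost surely, $$\mathbb{E}\big((X-\mathbb{E}(X|\mathcal{G}))^2\,\big|\,\mathcal{G}\big)\le \mathbb{E}\big((X-\mathbb{E}(X|\mathcal{F}))^2\,\big|\,\mathcal{G}\big)$$ and $$\mathbb{E}\big((X-\mathbb{E}(X|\mathcal{G}))^2\,\big|\,\mathcal{F}\big)\le \mathbb{E}\big((X-\mathbb{E}(X|\mathcal{F}))^2\,\big|\,\mathcal{F}\big).$$ Moreover, $\mathbb{E}\big(\mathbb{E}(X|\mathcal{G})\big)=\mathbb{E}\big(\mathbb{E}(X|\mathcal{F})\big)=\mathbb{E}(X)$.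
   Context: For a sub-$\sigma$-field $\mathcal{A}$ and a random variable $Y$, the mean squared distance between $X$ and $Y$ conditional on $\mathcal{A}$ means $\mathbb{E}\big((X-Y)^2\,\big|\,\mathcal{A}\big)$. *)

(* Defs.v *)
From HB Require Import structures.
From mathcomp Require Import all_boot all_order all_algebra.
From mathcomp Require Import all_classical all_reals all_analysis.
From mathcomp Require Import measurable_realfun.

Set Implicit Arguments.
Unset Strict Implicit.
Unset Printing Implicit Defensive.

Import Order.TTheory GRing.Theory Num.Theory.
Import numFieldNormedType.Exports.

Local Open Scope classical_set_scope.
Local Open Scope ring_scope.
Local Open Scope ereal_scope.

(* [Y] is a version of [E(X | A)]. The sigma-field is [<<s A >>], which is [A]
   itself when [A] is a sigma-field ([sigma_algebra_id]). *)
Definition is_condexp (d : measure_display) (T : measurableType d)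
    (R : realType) (P : probability T R) (A : set (set T)) (X Y : T -> R)
    : Prop :=
  [/\ @measurable_fun _ _ (g_sigma_algebraType A) R [set: T] Y,
      P.-integrable [set: T] (EFin \o Y) &
      forall B : set T, A.-sigma.-measurable B ->
        \int[P]_(w in B) (Y w)%:E = \int[P]_(w in B) (X w)%:E].

(* A chosen version of [E(X | A)]; by [condexpP] and [is_condexp_ae_eq] below
   one exists and is almost surely unique as soon as [X] is integrable and
   [A] consists of measurable sets. The value when [X] has no (integrable)
   version is irrelevant, and set to [0]. *)
Definition condexp (d : measure_display) (T : measurableType d)
    (R : realType) (P : probability T R) (A : set (set T)) (X : T -> R)
    : T -> R :=
  xget (cst 0%R) [set Y | is_condexp P A X Y].

Section condexp_wd.
Context (d : measure_display) (T : measurableType d) (R : realType)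
  (P : probability T R) (A : set (set T)) (X : T -> R).
Hypothesis Asub : A `<=` measurable.

Let sAsub : <<s A >> `<=` measurable.
Proof. by apply: smallest_sub => //; exact: sigma_algebra_measurable. Qed.

Let AT : measurableType A.-sigma := g_sigma_algebraType A.
Let toA : T -> AT := id.

Let mtoA : measurable_fun [set: T] toA.
Proof. by move=> _ B mB; rewrite setTI; exact: sAsub. Qed.

Let Q : set AT -> \bar R := pushforward P toA.

#[local] HB.instance Definition _ := Measure.copy Q
  (measure_function_pushforward__canonical__measure_function_Measure P mtoA).

Let QT : Q [set: AT] = 1.
Proof. by rewrite /Q /pushforward preimage_setT probability_setT. Qed.

#[local] HB.instance Definition _ := Measure_isProbability.Build _ _ _ Q QT.

Lemma is_condexp_exists : P.-integrable [set: T] (EFin \o X) ->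
  exists Y, is_condexp P A X Y.
Proof.
move=> iX.
pose nu : {charge set AT -> \bar R} :=
  measure_function_pushforward__canonical__charge_Charge
    (induced_charge iX) mtoA.
have nuE B : nu B = \int[P]_(w in B) (X w)%:E by [].
have nuQ : nu `<< Q.
  apply/null_content_dominatesP => B mB QB0; rewrite nuE.
  apply: null_set_integral => //; first exact: sAsub.
  by apply: measurable_funTS; exact: measurable_int iX.
have [f [ffin fint fE]] : exists f : AT -> \bar R,
    [/\ (forall x, f x \is a fin_num), Q.-integrable [set: AT] f &
     forall B, measurable B -> nu B = \int[Q]_(x in B) f x].
  exists (Radon_Nikodym nu Q); split.
  - by move=> x; exact: Radon_Nikodym_fin_num.
  - exact: Radon_Nikodym_integrable.
  - by move=> B mB; exact: Radon_Nikodym_integral.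
have mf : measurable_fun [set: AT] f by exact: measurable_int fint.
have fineE : EFin \o (fine \o f) = f by apply/funext => x /=; rewrite fineK.
have iP : P.-integrable [set: T] f.
  apply/integrableP; split.
    by move=> _ B mB; apply: sAsub; exact: mf.
  have /integrableP[_] := fint.
  rewrite (@ge0_integral_pushforward _ _ _ _ _ _ mtoA)//.
  by exact: measurableT_comp.
exists (fine \o f); split.
- by apply: measurableT_comp mf; exact: fine_measurable.
- by rewrite fineE.
- move=> B mB; rewrite -nuE fE//.
  rewrite (@integral_pushforward _ _ _ _ _ _ mtoA)//; last first.
    by apply: integrableS iP => //; exact: sAsub.
  by apply: eq_integral => x _ /=; rewrite fineK.
Qed.

Lemma condexpP : P.-integrable [set: T] (EFin \o X) ->
  is_condexp P A X (condexp P A X).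
Proof. by move=> /is_condexp_exists[Y XY]; exact: (xgetI _ XY). Qed.

Lemma is_condexp_ae_eq (Y Z : T -> R) :
  is_condexp P A X Y -> is_condexp P A X Z -> {ae P, forall w, Y w = Z w}.
Proof.
move=> [mY iY EY] [mZ iZ EZ].
have [N [mN QN0 YZN]] : ae_eq Q [set: AT] (EFin \o Y) (EFin \o Z).
  have iQ (U : T -> R) : @measurable_fun _ _ AT R [set: T] U ->
      P.-integrable [set: T] (EFin \o U) ->
      Q.-integrable [set: AT] (EFin \o U).
    move=> mU iU; apply: (@integrable_pushforward _ _ _ _ _ _ mtoA) => //.
    exact/measurable_EFinP.
  have intQ (U : T -> R) (B : set AT) :
      @measurable_fun _ _ AT R [set: T] U ->
      P.-integrable [set: T] (EFin \o U) -> measurable B ->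
      \int[Q]_(x in B) (U x)%:E = \int[P]_(x in B) (U x)%:E.
    move=> mU iU mB.
    rewrite (@integral_pushforward _ _ _ _ _ _ mtoA P B (EFin \o U))//.
      exact/measurable_EFinP.
    by apply: integrableS iU => //; exact: sAsub.
  apply: integral_ae_eq => //; first exact: iQ.
    exact/measurable_EFinP.
  by move=> B _ mB; rewrite !intQ// EY// EZ.
exists N; split => //; first exact: sAsub.
by move=> w /= YZ; apply: YZN => /= /(_ I)[].
Qed.

End condexp_wd.

(* Main.v *)
Require Import Defs.
From HB Require Import structures.
From mathcomp Require Import all_boot all_order all_algebra.
From mathcomp Require Import all_classical all_reals all_analysis.
From mathcomp Require Import measurable_realfun.
From mathcomp Require Import lra.

(* Let Y = E(X | A). The residual X - Y integrates to zero over every set of A,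
   hence (simple functions, then dominated convergence) it is orthogonal to
   every A-measurable U with U (X - Y) integrable. Expanding
   (X - Z)^2 = (X - Y)^2 + 2 (X - Y) (Y - Z) + (Y - Z)^2 then gives
   E((X - Y)^2; B) <= E((X - Z)^2; B) for all B in A and all square integrable
   A-measurable Z. With A = G and Z = E(X | F), this comparison of integrals
   over the sets of G, and a fortiori over those of F, passes to the
   conditional expectations given G and given F. *)

Set Implicit Arguments.
Unset Strict Implicit.
Unset Printing Implicit Defensive.

Import Order.TTheory GRing.Theory Num.Theory.
Import numFieldNormedType.Exports.

Local Open Scope classical_set_scope.
Local Open Scope ring_scope.

Section condexp_theory.
Context (d : measure_display) (T : measurableType d) (R : realType)
  (P : probability T R) (A : set (set T)).
Hypothesis Asub : A `<=` measurable.

Let AT : measurableType A.-sigma := g_sigma_algebraType A.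

(** * Measurability and indicators relative to the sub-sigma-field *)

Lemma sub_gsigma (B : set T) : A.-sigma.-measurable B -> measurable B.
Proof.
by apply: smallest_sub => //; exact: sigma_algebra_measurable.
Qed.

Lemma gsigma_measurable_fun (U : T -> R) :
  @measurable_fun _ _ AT R [set: T] U -> measurable_fun [set: T] U.
Proof. by move=> mU mT B mB; apply: sub_gsigma; exact: mU. Qed.

(** Moves the restriction to [B] into the integrand, where the indicator can be absorbed into a
    multiplier [U] measurable for the sub-sigma-field. *)
Lemma integral_indicM (B : set T) (D : T -> R) : measurable B ->
  (\int[P]_w (\1_B w * D w)%:E = \int[P]_(w in B) (D w)%:E)%E.
Proof.
move=> mB; rewrite [RHS]integral_mkcond; apply: eq_integral => w _.
by rewrite patchE indicE; case: (w \in B); rewrite ?mul1r ?mul0r.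
Qed.

Lemma integrable_indicM (B : set T) (D : T -> R) : measurable B ->
  P.-integrable [set: T] (EFin \o D) ->
  P.-integrable [set: T] (fun w => (\1_B w * D w)%:E).
Proof.
move=> mB iD; apply: (le_integrable measurableT _ _ iD).
  apply/measurable_EFinP; apply: measurable_funM => //.
  by apply/measurable_EFinP; exact: measurable_int iD.
move=> w _ /=; rewrite lee_fin normrM indicE.
by case: (_ \in _); rewrite ?normr1 ?mul1r// normr0 mul0r.
Qed.

(** * Orthogonality of the residual to the sub-sigma-field *)

Section orthogonality.
Variable D : T -> R.
Hypothesis iD : P.-integrable [set: T] (EFin \o D).
Hypothesis D0 : forall B, A.-sigma.-measurable B ->
  (\int[P]_(w in B) (D w)%:E = 0)%E.

Let mD : measurable_fun [set: T] D.
Proof. by apply/measurable_EFinP; exact: measurable_int iD. Qed.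

Import HBNNSimple.

(** The level sets of [g] lie in the sub-sigma-field, so [D0] kills each term of the finite sum over
    the values of [g]. *)
Let integral_nnsfunM0 (g : {nnsfun AT >-> R}) :
  (\int[P]_w (g w * D w)%:E = 0)%E.
Proof.
have mg y : A.-sigma.-measurable (g @^-1` [set y]).
  by rewrite -[X in measurable X]setTI; exact: (@measurable_funPT _ _ AT R g).
under eq_integral => w _.
  rewrite (fimfunE g) fsbig_finite; last exact: fimfunP.
  rewrite mulr_suml -sumEFin.
  under eq_bigr => y _ do rewrite -mulrA EFinM.
  over.
have i1D y : P.-integrable [set: T]
    (fun w => (\1_(g @^-1` [set y]) w * D w)%:E).
  by apply: integrable_indicM => //; exact: (sub_gsigma (mg y)).
rewrite integral_sum//; last by move=> y; exact: integrableZl.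
rewrite big1// => y _; rewrite integralZl//.
by rewrite integral_indicM ?D0 ?mule0//; exact: (sub_gsigma (mg y)).
Qed.

(** Simple functions [g n] increase to [U]; since [0 <= g n <= U], the function [|U D|] dominates
    every [g n * D]. *)
Let ge0_integral_gsigmaM0 (U : T -> R) :
  @measurable_fun _ _ AT R [set: T] U -> (forall w, 0 <= U w) ->
  P.-integrable [set: T] (fun w => (U w * D w)%:E) ->
  (\int[P]_w (U w * D w)%:E = 0)%E.
Proof.
move=> mU U0 iUD.
have mEU : @measurable_fun _ _ AT (\bar R) [set: T] (EFin \o U).
  exact/measurable_EFinP.
pose g := nnsfun_approx (@measurableT _ AT) mEU.
have gU w : EFin \o g ^~ w @ \oo --> (EFin \o U) w.
  by apply: cvg_nnsfun_approx => // t _; rewrite lee_fin.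
have ndg w : nondecreasing_seq (g ^~ w).
  by move=> m n /(nd_nnsfun_approx (@measurableT _ AT) mEU)/lefP.
have gr w : g ^~ w @ \oo --> U w by exact: (fine_cvg (gU w)).
have g_le n w : g n w <= U w.
  rewrite -(cvg_lim _ (gr w))//; apply: nondecreasing_cvgn_le => //.
  by apply/cvg_ex; exists (U w).
have [|||||_ _] := @dominated_convergence _ T R P setT measurableT
  (fun n w => (g n w * D w)%:E) (fun w => (U w * D w)%:E)
  (abse \o (fun w => (U w * D w)%:E)).
- move=> n; apply/measurable_EFinP; apply: measurable_funM => //.
  exact: gsigma_measurable_fun.
- exact: measurable_int iUD.
- apply: aeW => w _; apply: cvg_EFin; first exact: nearW.
  by apply: cvgM (gr w) _; exact: cvg_cst.
- exact: integrable_abse.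
- apply: aeW => w n _ /=; rewrite lee_fin !normrM ler_wpM2r//.
  by rewrite !ger0_norm.
under eq_fun do rewrite integral_nnsfunM0.
by move/cvg_lim => <-//; rewrite lim_cst.
Qed.

(** The positive and negative parts of [U] are both bounded by [|U|], so each inherits the
    integrability of [U D] and falls under the nonnegative case. *)
Lemma integral_gsigmaM0 (U : T -> R) :
  @measurable_fun _ _ AT R [set: T] U ->
  P.-integrable [set: T] (fun w => (U w * D w)%:E) ->
  (\int[P]_w (U w * D w)%:E = 0)%E.
Proof.
move=> mU iUD.
have part (V : T -> R) : @measurable_fun _ _ AT R [set: T] V ->
    (forall w, 0 <= V w <= `|U w|) ->
    P.-integrable [set: T] (fun w => (V w * D w)%:E) /\
    (\int[P]_w (V w * D w)%:E = 0)%E.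
  move=> mV VU.
  have iVD : P.-integrable [set: T] (fun w => (V w * D w)%:E).
    apply: (le_integrable measurableT _ _ iUD).
      apply/measurable_EFinP; apply: measurable_funM => //.
      exact: gsigma_measurable_fun.
    move=> w _ /=; rewrite lee_fin !normrM ler_wpM2r//.
    by have /andP[V0 ?] := VU w; rewrite ger0_norm.
  by split=> //; apply: ge0_integral_gsigmaM0 => // w; case/andP: (VU w).
have UE w : U^\+ w + U^\- w = `|U w|.
  by have /(congr1 (@^~ w)) := funrposDneg U.
have [||ip ip0] := part U^\+; first exact: measurable_funrpos.
  by move=> w; rewrite funrpos_ge0 -UE lerDl funrneg_ge0.
have [||im im0] := part U^\-; first exact: measurable_funrneg.
  by move=> w; rewrite funrneg_ge0 -UE lerDr funrpos_ge0.
under eq_integral => w _.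
  have /(congr1 (@^~ w)) /= <- := funrposBneg U.
  rewrite mulrBl EFinB; over.
by rewrite integralB_EFin// ip0 im0 sube0.
Qed.

End orthogonality.

(** Supplies hypothesis [D0] of the orthogonality section for [D = X - Y]. *)
Lemma is_condexp_integral_residual (X Y : T -> R) :
  P.-integrable [set: T] (EFin \o X) -> is_condexp P A X Y ->
  forall B, A.-sigma.-measurable B ->
    (\int[P]_(w in B) (X w - Y w)%:E = 0)%E.
Proof.
move=> iX [mY iY EY] B mB; have mB' := sub_gsigma mB.
have iXB : P.-integrable B (EFin \o X) by exact: integrableS iX.
have iYB : P.-integrable B (EFin \o Y) by exact: integrableS iY.
under eq_integral do rewrite EFinB.
by rewrite integralB_EFin// EY// subee// integrable_fin_num.
Qed.

(** * Square integrability and the least squares property *)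

Lemma Lfun2_integrable (f : T -> R) : f \in Lfun P 2%:E ->
  P.-integrable [set: T] (EFin \o f).
Proof.
move=> f2; apply/Lfun1_integrable; apply: Lfun_subset12 => //.
exact: fin_num_measure.
Qed.

Lemma integrable_sqr_Lfun2 (f : T -> R) : measurable_fun [set: T] f ->
  (\int[P]_w (f w ^+ 2)%:E < +oo)%E -> f \in Lfun P 2%:E.
Proof.
move=> mf if2; rewrite inE; apply/andP; split; rewrite inE//= /finite_norm.
rewrite unlock; apply: poweR_lty.
under eq_integral => w _.
  rewrite abse_EFin poweR_EFin powR_mulrn// -normrX ger0_norm ?sqr_ge0//.
  over.
exact: if2.
Qed.

Lemma Lfun2B (f g : T -> R) : f \in Lfun P 2%:E -> g \in Lfun P 2%:E ->
  f \- g \in Lfun P 2%:E.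
Proof. by move=> f2 g2; rewrite rpredB ?lee1n. Qed.

(* [Y] is truncated on [F n = {|Y| <= n}], which lies in the sigma-field: the
   pointwise bound [Y^2 <= X^2 - 2 Y (X - Y)] integrates there to
   [E(Y^2; F n) <= E(X^2)] because [Y 1_(F n)] is orthogonal to [X - Y]. *)
Lemma is_condexp_Lfun2 (X Y : T -> R) :
  X \in Lfun P 2%:E -> is_condexp P A X Y -> Y \in Lfun P 2%:E.
Proof.
move=> X2 XY; have [mY iY _] := XY; have iX := Lfun2_integrable X2.
have iX2 := Lfun2_integrable_sqr X2.
have mY' := gsigma_measurable_fun mY.
have iD : P.-integrable [set: T] (EFin \o (fun w => X w - Y w)).
  exact: (integrableB measurableT iX iY).
have D0 := is_condexp_integral_residual iX XY.
apply: integrable_sqr_Lfun2 => //.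
pose F n := [set w | `|Y w| <= n%:R].
have mF n : A.-sigma.-measurable (F n).
  rewrite -[F n]setTI; apply: (@measurable_fun_le _ AT R) => //.
  exact: measurableT_comp.
have FT : \bigcup_n F n = [set: T].
  apply/seteqP; split=> // w _; exists (Num.truncn `|Y w|).+1 => //=.
  exact/ltW/truncnS_gt.
have le_FX n : (\int[P]_(w in F n) (Y w ^+ 2)%:E <= \int[P]_w (X w ^+ 2)%:E)%E.
  have mF' := sub_gsigma (mF n).
  pose U w := \1_(F n) w * Y w.
  have mU : @measurable_fun _ _ AT R [set: T] U.
    exact: measurable_funM.
  have iUD : P.-integrable [set: T] (fun w => (U w * (X w - Y w))%:E).
    (* The truncation gives [|U| <= n], so [n |X - Y|] is an integrable bound. *)
    apply: (le_integrable measurableT _ _ (integrableZl measurableT n%:R iD)).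
      apply/measurable_EFinP; apply: measurable_funM.
        exact: gsigma_measurable_fun.
      by apply/measurable_EFinP; exact: measurable_int iD.
    move=> w _ /=; rewrite lee_fin !normrM.
    rewrite !normr_nat ler_wpM2r//.
    by case: (boolP (w \in F n)) => [|_]; rewrite ?mul0r// inE mul1r.
  have UD0 := integral_gsigmaM0 iD D0 mU iUD.
  rewrite -integral_indicM//.
  (* The zero subtracted on the right is rewritten as twice the integral of [U (X - Y)], which
     reduces the claim to a pointwise inequality. *)
  rewrite -[leRHS]sube0 -[X in (_ - X)%E](mule0 2%:E) -UD0 -integralZl//.
  rewrite -integralB_EFin//; last exact: integrableZl iUD.
  apply: ge0_le_integral => //.
  - by move=> w _; rewrite lee_fin mulr_ge0 ?sqr_ge0.
  - apply/measurable_EFinP; apply: measurable_funM => //.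
    exact: measurable_funX.
  - apply: measurable_int (integrableB measurableT iX2 _).
    exact: integrableZl iUD.
  - move=> w _ /=; rewrite -EFinD lee_fin /U indicE.
    (* On [F n] the two sides differ by [(X - Y)^2]; off [F n] only [0 <= X^2] remains. *)
    have := sqr_ge0 (X w - Y w); have := sqr_ge0 (X w).
    by case: (w \in F n); rewrite ?mul1r ?mul0r; nra.
apply: le_lt_trans (integrable_lty _ iX2) => //.
have ndF : nondecreasing_seq F.
  move=> m n mn; apply/subsetPset => w /= /le_trans; apply.
  by rewrite ler_nat.
(* The bound is uniform in [n], and the sets [F n] increase to the whole space: monotone convergence
   removes the truncation. *)
have cvgF : (\int[P]_(w in F n) (Y w ^+ 2)%:E @[n --> \oo] -->
    \int[P]_w (Y w ^+ 2)%:E)%E.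
  rewrite -FT; apply: ge0_nondecreasing_set_cvg_integral => //.
  - by move=> n; exact: sub_gsigma.
  - move=> n; apply/measurable_EFinP/measurable_funTS.
    exact: measurable_funX.
  - by move=> n w _; rewrite lee_fin sqr_ge0.
rewrite -(cvg_lim _ cvgF)//.
apply: lime_le; first by apply/cvg_ex; eexists; exact: cvgF.
by apply: nearW => n; exact: le_FX.
Qed.

(* With [U = 1_B (Y - Z)], one has
   [1_B (X - Y)^2 <= 1_B (X - Z)^2 - 2 U (X - Y)], and the last term integrates
   to zero. *)
Lemma is_condexp_integral_sqr_min (X Y Z : T -> R) (B : set T) :
  X \in Lfun P 2%:E -> is_condexp P A X Y ->
  Z \in Lfun P 2%:E -> @measurable_fun _ _ AT R [set: T] Z ->
  A.-sigma.-measurable B ->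
  (\int[P]_(w in B) ((X w - Y w) ^+ 2)%:E <=
   \int[P]_(w in B) ((X w - Z w) ^+ 2)%:E)%E.
Proof.
move=> X2 XY Z2 mZ mB; have mB' := sub_gsigma mB.
have [mY iY _] := XY; have Y2 := is_condexp_Lfun2 X2 XY.
have iX := Lfun2_integrable X2.
have D2 : (fun w => X w - Y w) \in Lfun P 2%:E by exact: (Lfun2B X2 Y2).
have E2 : (fun w => X w - Z w) \in Lfun P 2%:E by exact: (Lfun2B X2 Z2).
have V2 : (fun w => Y w - Z w) \in Lfun P 2%:E by exact: (Lfun2B Y2 Z2).
have iD2 := Lfun2_integrable_sqr D2; have iE2 := Lfun2_integrable_sqr E2.
(* Square integrability of [Y] enters here: it makes [(Y - Z) (X - Y)] integrable, as orthogonality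
   requires. *)
have /Lfun1_integrable iVD := Lfun2_mul_Lfun1 V2 D2.
pose U w := \1_B w * (Y w - Z w).
have mU : @measurable_fun _ _ AT R [set: T] U.
  by apply: measurable_funM => //; exact: measurable_funB.
have iUD : P.-integrable [set: T] (fun w => (U w * (X w - Y w))%:E).
  under eq_fun do rewrite -mulrA.
  exact: integrable_indicM.
have UD0 := integral_gsigmaM0 (Lfun2_integrable D2)
  (is_condexp_integral_residual iX XY) mU iUD.
have i1 : P.-integrable [set: T] (fun w => (\1_B w * (X w - Y w) ^+ 2)%:E).
  exact: integrable_indicM.
have i2 : P.-integrable [set: T] (fun w => (\1_B w * (X w - Z w) ^+ 2)%:E).
  exact: integrable_indicM.
have i2UD := integrableZl measurableT 2%R iUD.
rewrite -(integral_indicM _ mB') -[leRHS](integral_indicM _ mB').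
rewrite -[leRHS]sube0 -[X in (_ - X)%E](mule0 2%:E) -UD0 -integralZl//.
rewrite -(integralB_EFin measurableT i2 i2UD).
apply: le_integral => //.
  exact: (integrableB measurableT i2 i2UD).
move=> w _ /=; rewrite -EFinD lee_fin /U indicE.
(* On [B] the two sides differ by exactly [(Y - Z)^2]. *)
have := sqr_ge0 (Y w - Z w).
by case: (w \in B); rewrite ?mul1r ?mul0r; nra.
Qed.

(** * From integrals to conditional expectations *)

(** The exceptional set [B] where [W' < V'] lies in the sub-sigma-field. The integral of [V' - W']
    over it is nonnegative by the choice of [B] and nonpositive by hypothesis, so [V' = W'] almost
    everywhere on [B], which makes [B] null. *)
Lemma condexp_le (V W : T -> R) :
  P.-integrable [set: T] (EFin \o V) -> P.-integrable [set: T] (EFin \o W) ->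
  (forall B, A.-sigma.-measurable B ->
    (\int[P]_(w in B) (V w)%:E <= \int[P]_(w in B) (W w)%:E)%E) ->
  {ae P, forall w, condexp P A V w <= condexp P A W w}.
Proof.
move=> iV iW VW.
have [mV' iV' EV] := condexpP Asub iV; have [mW' iW' EW] := condexpP Asub iW.
set V' := condexp P A V in mV' iV' EV *.
set W' := condexp P A W in mW' iW' EW *.
pose B := [set w | W' w < V' w].
have mB : A.-sigma.-measurable B.
  by rewrite -[B]setTI; exact: (@measurable_fun_ltr _ AT).
have mB' := sub_gsigma mB.
have iVB : P.-integrable B (EFin \o V') by exact: integrableS iV'.
have iWB : P.-integrable B (EFin \o W') by exact: integrableS iW'.
have iVWB := integrableB mB' iVB iWB.
have : (\int[P]_(w in B) `|(V' w)%:E - (W' w)%:E| = 0)%E.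
  under eq_integral => w wB.
    rewrite gee0_abs; last first.
      by rewrite -EFinB lee_fin subr_ge0 ltW//; move: wB; rewrite inE.
    over.
  apply/eqP; rewrite eq_le; apply/andP; split.
    rewrite integralB_EFin// EV// EW// sube_le0; exact: VW.
  by apply: integral_ge0 => w wB; rewrite -EFinB lee_fin subr_ge0 ltW.
move/(ae_eq_integral_abs P mB' (measurable_int _ iVWB)).
apply: filterS => w VW0; rewrite leNgt; apply/negP => wB.
have [/eqP] := VW0 wB.
by rewrite subr_eq0 => /eqP VWw; move: wB; rewrite VWw ltxx.
Qed.

End condexp_theory.

(** * The two inequalities and the equality of means *)

Theorem proposition1 (d : measure_display) (T : measurableType d)
    (R : realType) (P : probability T R) (F G : set (set T))
    (sF : sigma_algebra [set: T] F) (sG : sigma_algebra [set: T] G)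
    (FG : F `<=` G) (GH : G `<=` measurable)
    (X : {RV P >-> R}) (X2 : (X : T -> R) \in Lfun P 2%:E) :
  [/\ {ae P, forall w,
        condexp P G (fun v => (X v - condexp P G X v) ^+ 2) w <=
        condexp P G (fun v => (X v - condexp P F X v) ^+ 2) w},
      {ae P, forall w,
        condexp P F (fun v => (X v - condexp P G X v) ^+ 2) w <=
        condexp P F (fun v => (X v - condexp P F X v) ^+ 2) w},
      'E_P[condexp P G X]%E = 'E_P[condexp P F X]%E &
      'E_P[condexp P F X]%E = 'E_P[X]%E].
Proof.
have FH : F `<=` measurable by exact: subset_trans GH.
have sFG (B : set T) : F.-sigma.-measurable B -> G.-sigma.-measurable B.
  exact: sub_sigma_algebra2.
have iX := Lfun2_integrable X2.
have XG := condexpP GH iX; have XF := condexpP FH iX.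
have G2 := is_condexp_Lfun2 GH X2 XG; have F2 := is_condexp_Lfun2 FH X2 XF.
(* Being measurable for the smaller field [F], this version is measurable for [G] and may compete as
   [Z]. *)
have mF : @measurable_fun _ _ (g_sigma_algebraType G) R [set: T]
    (condexp P F X).
  by case: XF => mF _ _ mT B mB; apply: sFG; exact: mF.
have iXG2 := Lfun2_integrable_sqr (Lfun2B X2 G2).
have iXF2 := Lfun2_integrable_sqr (Lfun2B X2 F2).
have min_G (B : set T) : G.-sigma.-measurable B ->
  (\int[P]_(w in B) ((X w - condexp P G X w) ^+ 2)%:E <=
   \int[P]_(w in B) ((X w - condexp P F X w) ^+ 2)%:E)%E.
  exact: is_condexp_integral_sqr_min.
(* The defining identity of a version, taken over the whole space. *)
have expectE (A : set (set T)) : A `<=` measurable ->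
    'E_P[condexp P A X]%E = 'E_P[X]%E.
  by move=> AH; have [_ _ XA] := condexpP AH iX; rewrite unlock XA.
split.
- exact: condexp_le.
- by apply: condexp_le => // B /sFG; exact: min_G.
- by rewrite !expectE.
- exact: expectE.
Qed.
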